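(* Let $(A,\cdot,\{\,,\,,\,\})$ be a Nambu-Poisson algebra and $N:A\to A$ be a Nijenhuis operator on it. Define operations, for $a,b,c\in A$, $$a\diamond_N b:=N(a)\cdot b,\quad a*_N b:=-N(a\cdot b),\quad [a,b,c]_N:=\{N(a),N(b),c\},$$ $$[\![a,b,c]\!]_N:=-N\big(\{N(a),b,c\}+\{a,N(b),c\}+\{a,b,N(c)\}-N\{a,b,c\}\big).$$ Then $(A,\diamond_N,*_N,[\,,\,,\,]_N,[\![\,,\,,\,]\!]_N)$ is an NS-Nambu-Poisson algebra. Moreover, the corresponding subadjacent Nambu-Poisson algebra structure coincides with the deformed Nambu-Poisson algebra $A_N=(A,\cdot_N,\{\,,\,,\,\}_N)$, where $a\cdot_N b=N(a)\cdot b+a\cdot N(b)-N(a\cdot b)$ and $\{a,b,c\}_N=\{N(a),N(b),c\}+\{N(a),b,N(c)\}+\{a,N(b),N(c)\}-N\big(\{N(a),b,c\}+\{a,N(b),c\}+\{a,b,N(c)\}-N\{a,b,c\}\big)$.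
   Context: All vector spaces and (multi)linear maps are over a field $k$ of characteristic $0$. A 3-Lie algebra is a vector space $\mathcal L$ with a skew-symmetric trilinear operation $\{\,,\,,\,\}$ satisfying $\{a,b,\{c,d,e\}\}=\{\{a,b,c\},d,e\}+\{c,\{a,b,d\},e\}+\{c,d,\{a,b,e\}\}$. A Nambu-Poisson algebra $(A,\cdot,\{\,,\,,\,\})$ is a commutative associative algebra $(A,\cdot)$ (not assumed unital) together with a 3-Lie algebra structure $\{\,,\,,\,\}$ on $A$ such that $\{a,b,c\cdot d\}=\{a,b,c\}\cdot d+c\cdot\{a,b,d\}$ for all $a,b,c,d\in A$. A linear map $N:A\to A$ is a Nijenhuis operator on $A$ if for all $a,b,c\in A$: $N(a)\cdot N(b)=N\big(N(a)\cdot b+a\cdot N(b)-N(a\cdot b)\big)$ and $\{N(a),N(b),N(c)\}=N\Big(\{N(a),N(b),c\}+\{N(a),b,N(c)\}+\{a,N(b),N(c)\}-N\big(\{N(a),b,c\}+\{a,N(b),c\}+\{a,b,N(c)\}-N\{a,b,c\}\big)\Big)$. An NS-commutative algebra is $(A,\diamond,* )$ with bilinear operations $\diamond,*$ on $A$, $*$ commutative, such that, with $a\odot b=a\diamond b+b\diamond a+a*b$: $a\diamond(b\diamond c)=(a\odot b)\diamond c$ and $a\diamond(b*c)+a*(b\odot c)=b\diamond(a*c)+b*(a\odot c)$. An NS-3-Lie algebra is $(A,[\,,\,,\,],[\![\,,\,,\,]\!])$ with trilinear operations on $A$, $[\,,\,,\,]$ skew-symmetric in the first two arguments and $[\![\,,\,,\,]\!]$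 completely skew-symmetric, such that, with $\{\!\!\{a,b,c\}\!\!\}=[a,b,c]+[b,c,a]+[c,a,b]+[\![a,b,c]\!]$: $[a,b,[c,d,e]]=[\{\!\!\{a,b,c\}\!\!\},d,e]+[c,\{\!\!\{a,b,d\}\!\!\},e]+[c,d,[a,b,e]]$; $[\{\!\!\{a,b,c\}\!\!\},d,e]=[a,b,[c,d,e]]+[b,c,[a,d,e]]+[c,a,[b,d,e]]$; $[\![a,b,\{\!\!\{c,d,e\}\!\!\}]\!]+[a,b,[\![c,d,e]\!]]=[\![\{\!\!\{a,b,c\}\!\!\},d,e]\!]+[\![c,\{\!\!\{a,b,d\}\!\!\},e]\!]+[\![c,d,\{\!\!\{a,b,e\}\!\!\}]\!]+[d,e,[\![a,b,c]\!]]+[e,c,[\![a,b,d]\!]]+[c,d,[\![a,b,e]\!]]$. An NS-Nambu-Poisson algebra is $(A,\diamond,*,[\,,\,,\,],[\![\,,\,,\,]\!])$ such that $(A,\diamond,* )$ is an NS-commutative algebra, $(A,[\,,\,,\,],[\![\,,\,,\,]\!])$ is an NS-3-Lie algebra, and for all $a,b,c,d\in A$: $\{\!\!\{a,b,c\}\!\!\}\diamond d=[a,b,c\diamond d]-c\diamond[a,b,d]$; $[a\odot b,c,d]=a\diamond[b,c,d]+b\diamond[a,c,d]$; $[\![a,b,c\odot d]\!]+[a,b,c*d]=c*\{\!\!\{a,b,d\}\!\!\}+c\diamond[\![a,b,d]\!]+\{\!\!\{a,b,c\}\!\!\}*d+d\diamond[\![a,b,c]\!]$. Its subadjacent Nambu-Poisson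 algebra is $(A,\odot,\{\!\!\{\,,\,,\,\}\!\!\})$. *)

(* Defs.v *)
From HB Require Import structures.
From mathcomp Require Import all_boot all_order all_algebra.

Set Implicit Arguments.
Unset Strict Implicit.
Unset Printing Implicit Defensive.

Import GRing.Theory.
Local Open Scope ring_scope.

Section Multilinear.
Variables (k : fieldType) (A : lmodType k).

Definition bilinear_op (m : A -> A -> A) : Prop :=
  (forall b, linear (fun a => m a b)) /\ (forall a, linear (fun b => m a b)).

Definition trilinear_op (t : A -> A -> A -> A) : Prop :=
  [/\ forall b c, linear (fun a => t a b c),
      forall a c, linear (fun b => t a b c)
    & forall a b, linear (fun c => t a b c)].

Definition skew12 (t : A -> A -> A -> A) : Prop :=
  forall a b c, t b a c = - t a b c.

(* The transpositions (1 2) and (2 3) generate S_3. *)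
Definition skew_symmetric3 (t : A -> A -> A -> A) : Prop :=
  skew12 t /\ (forall a b c, t a c b = - t a b c).

End Multilinear.

Section NambuPoisson.
Variables (k : fieldType) (A : lmodType k).

Record is_comm_assoc_algebra (mul : A -> A -> A) : Prop := {
  ca_bilinear : bilinear_op mul;
  ca_comm : commutative mul;
  ca_assoc : associative mul
}.

Record is_3Lie_algebra (br : A -> A -> A -> A) : Prop := {
  lie3_trilinear : trilinear_op br;
  lie3_skew : skew_symmetric3 br;
  lie3_fundamental : forall a b c d e,
    br a b (br c d e) =
      br (br a b c) d e + br c (br a b d) e + br c d (br a b e)
}.

Record is_Nambu_Poisson_algebra
    (mul : A -> A -> A) (br : A -> A -> A -> A) : Prop := {
  np_comm_assoc : is_comm_assoc_algebra mul;
  np_3Lie : is_3Lie_algebra br;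
  np_leibniz : forall a b c d,
    br a b (mul c d) = mul (br a b c) d + mul c (br a b d)
}.

Record is_Nijenhuis_operator
    (mul : A -> A -> A) (br : A -> A -> A -> A) (N : {linear A -> A}) : Prop := {
  nij_mul : forall a b,
    mul (N a) (N b) = N (mul (N a) b + mul a (N b) - N (mul a b));
  nij_br : forall a b c,
    br (N a) (N b) (N c) =
      N (br (N a) (N b) c + br (N a) b (N c) + br a (N b) (N c)
         - N (br (N a) b c + br a (N b) c + br a b (N c) - N (br a b c)))
}.

Definition deformed_mul (mul : A -> A -> A) (N : {linear A -> A}) (a b : A) : A :=
  mul (N a) b + mul a (N b) - N (mul a b).

Definition deformed_br (br : A -> A -> A -> A) (N : {linear A -> A})
    (a b c : A) : A :=
  br (N a) (N b) c + br (N a) b (N c) + br a (N b) (N c)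
  - N (br (N a) b c + br a (N b) c + br a b (N c) - N (br a b c)).

End NambuPoisson.

Section NSNambuPoisson.
Variables (k : fieldType) (A : lmodType k).

(* The operation a (.) b = a <> b + b <> a + a * b. *)
Definition ns_odot (dia star : A -> A -> A) (a b : A) : A :=
  dia a b + dia b a + star a b.

(* The bracket {{a,b,c}}; [br] is [ , , ] and [dbr] is [[ , , ]]. *)
Definition ns_bracket (br dbr : A -> A -> A -> A) (a b c : A) : A :=
  br a b c + br b c a + br c a b + dbr a b c.

Record is_NS_commutative_algebra (dia star : A -> A -> A) : Prop := {
  nsc_dia_bilinear : bilinear_op dia;
  nsc_star_bilinear : bilinear_op star;
  nsc_star_comm : commutative star;
  nsc_dia_dia : forall a b c, dia a (dia b c) = dia (ns_odot dia star a b) c;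
  nsc_dia_star : forall a b c,
    dia a (star b c) + star a (ns_odot dia star b c) =
    dia b (star a c) + star b (ns_odot dia star a c)
}.

Record is_NS_3Lie_algebra (br dbr : A -> A -> A -> A) : Prop := {
  nsl_br_trilinear : trilinear_op br;
  nsl_dbr_trilinear : trilinear_op dbr;
  nsl_br_skew : skew12 br;
  nsl_dbr_skew : skew_symmetric3 dbr;
  nsl_br_br : forall a b c d e,
    br a b (br c d e) =
      br (ns_bracket br dbr a b c) d e + br c (ns_bracket br dbr a b d) e
      + br c d (br a b e);
  nsl_bracket_br : forall a b c d e,
    br (ns_bracket br dbr a b c) d e =
      br a b (br c d e) + br b c (br a d e) + br c a (br b d e);
  nsl_dbr_bracket : forall a b c d e,
    dbr a b (ns_bracket br dbr c d e) + br a b (dbr c d e) =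
      dbr (ns_bracket br dbr a b c) d e + dbr c (ns_bracket br dbr a b d) e
      + dbr c d (ns_bracket br dbr a b e)
      + br d e (dbr a b c) + br e c (dbr a b d) + br c d (dbr a b e)
}.

Record is_NS_Nambu_Poisson_algebra
    (dia star : A -> A -> A) (br dbr : A -> A -> A -> A) : Prop := {
  nsnp_comm : is_NS_commutative_algebra dia star;
  nsnp_3Lie : is_NS_3Lie_algebra br dbr;
  nsnp_bracket_dia : forall a b c d,
    dia (ns_bracket br dbr a b c) d = br a b (dia c d) - dia c (br a b d);
  nsnp_br_odot : forall a b c d,
    br (ns_odot dia star a b) c d = dia a (br b c d) + dia b (br a c d);
  nsnp_dbr_odot : forall a b c d,
    dbr a b (ns_odot dia star c d) + br a b (star c d) =
      star c (ns_bracket br dbr a b d) + dia c (dbr a b d)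
      + star (ns_bracket br dbr a b c) d + dia d (dbr a b c)
}.

End NSNambuPoisson.

Section NijenhuisNS.
Variables (k : fieldType) (A : lmodType k).
Variables (mul : A -> A -> A) (br : A -> A -> A -> A) (N : {linear A -> A}).

Definition dia_N (a b : A) : A := mul (N a) b.

Definition star_N (a b : A) : A := - N (mul a b).

Definition br_N (a b c : A) : A := br (N a) (N b) c.

Definition dbr_N (a b c : A) : A :=
  - N (br (N a) b c + br a (N b) c + br a b (N c) - N (br a b c)).

End NijenhuisNS.

(* Main.v *)
Require Import Defs.
From HB Require Import structures.
From mathcomp Require Import all_boot all_order all_algebra.
Import GRing.Theory.
Local Open Scope ring_scope.

(* Write B for the deformed bracket and m for the deformed product, so that
   N (B a b c) = {Na, Nb, Nc} and N (m a b) = Na . Nb; the NS-axioms without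
   [[,,]] or * are then the Nambu-Poisson axioms with N inserted.  For the
   others, applying the Nijenhuis identity repeatedly gives
     [[a, b, B c d e]] + [a, b, [[c, d, e]]]
       = - N (T3 - N (T2 - N (T1 - N T0))),
   where Ti is the sum of the copies of {a, b, {c, d, e}} with N inserted at i of
   the five places.  Each Ti inherits the fundamental identity, hence so does the
   left-hand side, which is the last NS-3-Lie axiom; the remaining part of
   B a b (B c d e) is T4, so B satisfies the fundamental identity too.  The
   NS-commutative and Leibniz axioms follow in the same way from a . (b . c) and
   {a, b, c . d}. *)

(** * Reflexive decision of equalities in abelian groups *)

Inductive zterm := ZAtom of nat | ZZero | ZAdd of zterm & zterm | ZOpp of zterm.

Fixpoint zterm_coef (e : zterm) (i : nat) : int :=
  match e with
  | ZAtom j => (i == j)%:Z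
  | ZZero => 0
  | ZAdd e1 e2 => zterm_coef e1 i + zterm_coef e2 i
  | ZOpp e1 => - zterm_coef e1 i
  end.

Section Zterm.
Context {V : zmodType}.
Implicit Types (env : seq V) (e : zterm).

Fixpoint zterm_eval env e : V :=
  match e with
  | ZAtom i => env`_i
  | ZZero => 0
  | ZAdd e1 e2 => zterm_eval env e1 + zterm_eval env e2
  | ZOpp e1 => - zterm_eval env e1
  end.

(** Integer coefficients of the atoms give a normal form. An atom out of range evaluates to the
    default [0], in agreement with its absence from the sum. *)
Lemma zterm_evalE env e :
  zterm_eval env e = \sum_(i < size env) env`_i *~ zterm_coef e i.
Proof.
elim: e => /= [j||e1 -> e2 ->|e ->]; last 1 first.
- by rewrite -sumrN; apply: eq_bigr => i _; rewrite mulrNz.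
- have [ltj|lej] := ltnP j (size env).
    rewrite (bigD1 (Ordinal ltj)) //= eqxx big1 ?addr0 // => i.
    by rewrite -val_eqE /= => /negPf->.
  rewrite nth_default // big1 // => i _.
  by rewrite (ltn_eqF (leq_trans (ltn_ord i) lej)).
- by rewrite big1.
- by rewrite -big_split; apply: eq_bigr => i _; rewrite mulrzDr.
Qed.

Lemma zterm_eval_eq env e1 e2 :
  all (fun i => zterm_coef e1 i == zterm_coef e2 i) (iota 0 (size env)) ->
  zterm_eval env e1 = zterm_eval env e2.
Proof.
move/allP=> eq12; rewrite !zterm_evalE; apply: eq_bigr => i _.
by rewrite (eqP (eq12 i _)) // mem_iota ltn_ord.
Qed.

End Zterm.

Ltac zatom_index x env :=
  lazymatch env with
  | x :: _ => constr:(O)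
  | _ :: ?env' => let i := zatom_index x env' in constr:(S i)
  end.

Ltac zatom_insert x env :=
  lazymatch env with
  | context [x :: _] => env
  | _ => constr:(x :: env)
  end.

Ltac zatoms e env :=
  lazymatch e with
  | ?x + ?y => let env' := zatoms x env in zatoms y env'
  | - ?x => zatoms x env
  | 0 => env
  | _ => zatom_insert e env
  end.

Ltac zquote e env :=
  lazymatch e with
  | ?x + ?y =>
    let x' := zquote x env in let y' := zquote y env in constr:(ZAdd x' y')
  | - ?x => let x' := zquote x env in constr:(ZOpp x')
  | 0 => constr:(ZZero)
  | _ => let i := zatom_index e env in constr:(ZAtom i)
  end.

Ltac zmod_cancel :=
  lazymatch goal with
  | |- @eq ?T ?x ?y =>
    let env := zatoms x (@nil T) in
    let env := zatoms y env in
    let x' := zquote x env in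
    let y' := zquote y env in
    apply: (@zterm_eval_eq _ env x' y'); vm_compute; reflexivity
  end.

(** * Multilinear operations *)

Section Multilinearity.
Context {k : fieldType} {A : lmodType k}.

Section Linear.
Context {f : A -> A}.
Hypothesis linf : linear f.

Lemma linear_D x y : f (x + y) = f x + f y.
Proof. by have := linf 1 x y; rewrite !scale1r. Qed.

Lemma linear_Z t x : f (t *: x) = t *: f x.
Proof.
have f0 : f 0 = 0 by apply: (addIr (f 0)); rewrite -linear_D !add0r.
by have := linf t x 0; rewrite f0 !addr0.
Qed.

Lemma linear_N x : f (- x) = - f x.
Proof. by rewrite -scaleN1r linear_Z scaleN1r. Qed.

End Linear.

Section Bilinear.
Context {m : A -> A -> A}.
Hypothesis linm : bilinear_op m.

(** The rules for all slots form one tuple, so that a single repeated [rewrite] expands every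
    argument. *)
Lemma bilinearD :
  ((forall a a' b, m (a + a') b = m a b + m a' b)%R *
   (forall a b b', m a (b + b') = m a b + m a b')%R)%type.
Proof.
case: linm => m1 m2.
by split=> > ; [exact: (linear_D (m1 _)) | exact: (linear_D (m2 _))].
Qed.

Lemma bilinearN :
  ((forall a b, m (- a) b = - m a b)%R * (forall a b, m a (- b) = - m a b)%R)%type.
Proof.
case: linm => m1 m2.
by split=> > ; [exact: (linear_N (m1 _)) | exact: (linear_N (m2 _))].
Qed.

Lemma bilinearZ :
  ((forall x a b, m (x *: a) b = x *: m a b)%R *
   (forall x a b, m a (x *: b) = x *: m a b)%R)%type.
Proof.
case: linm => m1 m2.
by split=> > ; [exact: (linear_Z (m1 _)) | exact: (linear_Z (m2 _))].
Qed.

End Bilinear.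

Section Trilinear.
Context {t : A -> A -> A -> A}.
Hypothesis lint : trilinear_op t.

Lemma trilinearD :
  ((forall a a' b c, t (a + a') b c = t a b c + t a' b c)%R *
   (forall a b b' c, t a (b + b') c = t a b c + t a b' c)%R *
   (forall a b c c', t a b (c + c') = t a b c + t a b c')%R)%type.
Proof.
case: lint => t1 t2 t3; split; [split|] => >;
  [exact: (linear_D (t1 _ _)) | exact: (linear_D (t2 _ _)) |
   exact: (linear_D (t3 _ _))].
Qed.

Lemma trilinearN :
  ((forall a b c, t (- a) b c = - t a b c)%R *
   (forall a b c, t a (- b) c = - t a b c)%R *
   (forall a b c, t a b (- c) = - t a b c)%R)%type.
Proof.
case: lint => t1 t2 t3; split; [split|] => >;
  [exact: (linear_N (t1 _ _)) | exact: (linear_N (t2 _ _)) |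
   exact: (linear_N (t3 _ _))].
Qed.

Lemma trilinearZ :
  ((forall x a b c, t (x *: a) b c = x *: t a b c)%R *
   (forall x a b c, t a (x *: b) c = x *: t a b c)%R *
   (forall x a b c, t a b (x *: c) = x *: t a b c)%R)%type.
Proof.
case: lint => t1 t2 t3; split; [split|] => >;
  [exact: (linear_Z (t1 _ _)) | exact: (linear_Z (t2 _ _)) |
   exact: (linear_Z (t3 _ _))].
Qed.

End Trilinear.

End Multilinearity.

(** * Nijenhuis deformations *)

Section Nijenhuis.
Context {k : fieldType} {A : lmodType k}.
Context {mul : A -> A -> A} {br : A -> A -> A -> A} {N : {linear A -> A}}.
Hypothesis NP : is_Nambu_Poisson_algebra mul br.
Hypothesis Nij : is_Nijenhuis_operator mul br N.

Local Notation m := (deformed_mul mul N).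
Local Notation B := (deformed_br br N).
Local Notation dia := (dia_N mul N).
Local Notation star := (star_N mul N).
Local Notation brn := (br_N br N).
Local Notation dbr := (dbr_N br N).

Let mul_lin : bilinear_op mul := ca_bilinear (np_comm_assoc NP).
Let br_lin : trilinear_op br := lie3_trilinear (np_3Lie NP).
Let mulC : commutative mul := ca_comm (np_comm_assoc NP).
Let mulA : associative mul := ca_assoc (np_comm_assoc NP).
Let br12 : skew12 br := proj1 (lie3_skew (np_3Lie NP)).
Let br23 := proj2 (lie3_skew (np_3Lie NP)).
Let br_fund := lie3_fundamental (np_3Lie NP).
Let br_leib := np_leibniz NP.
Let mulE := (bilinearD mul_lin, bilinearN mul_lin).
Let brE := (trilinearD br_lin, trilinearN br_lin).
(* The library lemmas, keyed on the instances found in the statements, so that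
   [zmod_cancel], which compares atoms syntactically, recognizes the results. *)
Let scaleD x (a b : A) : x *: (a + b) = x *: a + x *: b := scalerDr x a b.
Let scaleN x (a : A) : x *: (- a) = - (x *: a) := scalerN x a.
Let ND a b : N (a + b) = N a + N b := linearD N a b.
Let NN a : N (- a) = - N a := linearN N a.
Let NZ x a : N (x *: a) = x *: N a := linearZZ N x a.
Let NE := (ND, NN).

Lemma br_rot a b c : br b c a = br a b c.
Proof. by rewrite br23 br12 opprK. Qed.

(* Here the terms on both sides are instances of one quinary operation. *)
Lemma br_fund_sym a b c d e :
  br a b (br c d e) = br d e (br a b c) + br e c (br a b d) + br c d (br a b e).
Proof. by rewrite br_fund (br_rot e c) -(br_rot (br a b c)). Qed.

(** * Multilinearity and symmetry of the four operations *)

Lemma star_bilinear : bilinear_op star.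
Proof.
by split=> >; rewrite /star_N !(NE, NZ, mulE, bilinearZ mul_lin) opprD scalerN.
Qed.

Lemma dia_bilinear : bilinear_op dia.
Proof. by split=> >; rewrite /dia_N !(NE, NZ, mulE, bilinearZ mul_lin). Qed.

Lemma brn_trilinear : trilinear_op brn.
Proof. by split=> >; rewrite /br_N !(NE, NZ, brE, trilinearZ br_lin). Qed.

Lemma dbr_trilinear : trilinear_op dbr.
Proof.
by split=> >; rewrite /dbr_N !(NE, NZ, brE, trilinearZ br_lin, scaleD, scaleN);
  zmod_cancel.
Qed.

Lemma dbr_skew : skew_symmetric3 dbr.
Proof.
split=> a b c; rewrite /dbr_N.
  rewrite (br12 a (N b)) (br12 (N a) b) !(br12 a b) !NE.
  zmod_cancel.
rewrite (br23 _ b (N c)) (br23 _ (N b) c) !(br23 _ b c) !NE.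
zmod_cancel.
Qed.

Lemma dbr_rot a b c : dbr b c a = dbr a b c.
Proof. by rewrite dbr_skew.2 dbr_skew.1 opprK. Qed.

(** * The deformed bracket and its fundamental identity *)

Lemma N_deformed_mul a b : N (m a b) = mul (N a) (N b).
Proof. by rewrite (nij_mul Nij). Qed.

Lemma N_deformed_br a b c : N (B a b c) = br (N a) (N b) (N c).
Proof. by rewrite (nij_br Nij). Qed.

Lemma odot_deformed a b : ns_odot dia star a b = m a b.
Proof. by rewrite /ns_odot /dia_N (mulC (N b)). Qed.

Lemma bracket_deformed a b c : ns_bracket brn dbr a b c = B a b c.
Proof.
rewrite /ns_bracket /br_N (br_rot a) -(br_rot (N c)) /deformed_br /dbr_N.
zmod_cancel.
Qed.

(** Expanding [mul (N c) (N x)] by the Nijenhuis identity cancels [mul c (N x)]. The shape [s - N x]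
    is that of a deformed product or bracket. *)
Lemma star_subN c s x :
  star c (s - N x) - dia c (N x) = - N (mul c s + mul (N c) x - N (mul c x)).
Proof.
rewrite /star_N /dia_N (nij_mul Nij) !(mulE, NE).
zmod_cancel.
Qed.

Lemma dbr_subN a b s x :
  dbr a b (s - N x) - brn a b (N x) =
  - N (br (N a) b s + br a (N b) s + br a b (N (s - N x)) + br (N a) (N b) x
       - N (br a b s + br (N a) b x + br a (N b) x - N (br a b x))).
Proof.
(* Naming this term protects it from [NE]: for [s - N x] equal to [B c d e] it is to become
   [br (N c) (N d) (N e)]. *)
rewrite /dbr_N /br_N (nij_br Nij); set y := N (s - _).
rewrite !(brE, NE).
zmod_cancel.
Qed.

Lemma dbr_deformed_br a b c d e :
  dbr a b (B c d e) + brn a b (dbr c d e) =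
  - N (br (N a) b (br (N c) (N d) e) + br (N a) b (br (N c) d (N e))
       + br (N a) b (br c (N d) (N e)) + br a (N b) (br (N c) (N d) e)
       + br a (N b) (br (N c) d (N e)) + br a (N b) (br c (N d) (N e))
       + br a b (br (N c) (N d) (N e)) + br (N a) (N b) (br (N c) d e)
       + br (N a) (N b) (br c (N d) e) + br (N a) (N b) (br c d (N e))
       - N (br a b (br (N c) (N d) e) + br a b (br (N c) d (N e))
            + br a b (br c (N d) (N e)) + br (N a) b (br (N c) d e)
            + br (N a) b (br c (N d) e) + br (N a) b (br c d (N e))
            + br a (N b) (br (N c) d e) + br a (N b) (br c (N d) e)
            + br a (N b) (br c d (N e)) + br (N a) (N b) (br c d e)
            - N (br (N a) b (br c d e) + br a (N b) (br c d e)
                 + br a b (br (N c) d e) + br a b (br c (N d) e)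
                 + br a b (br c d (N e)) - N (br a b (br c d e))))).
Proof.
(* Since [B c d e] is [s - N x] and [dbr c d e] is [- N x] for the same [x], the left-hand side
   takes the form treated by [dbr_subN]. *)
rewrite (_ : brn a b (dbr c d e) =
  - brn a b (N (br (N c) d e + br c (N d) e + br c d (N e) - N (br c d e))));
  last by rewrite /br_N !brE.
rewrite dbr_subN N_deformed_br !(brE, (nij_br Nij), NE).
zmod_cancel.
Qed.

Lemma dbr_cocycle a b c d e :
  dbr a b (B c d e) + brn a b (dbr c d e) =
    dbr d e (B a b c) + brn d e (dbr a b c)
    + (dbr e c (B a b d) + brn e c (dbr a b d))
    + (dbr c d (B a b e) + brn c d (dbr a b e)).
Proof.
(* Fixing the first argument to [a] or [N a] restricts the rewriting to the left-hand terms; the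
   resulting ones start with [c], [d], [e] or their images. *)
rewrite !dbr_deformed_br !(br_fund_sym a) !(br_fund_sym (N a)) !NE.
zmod_cancel.
Qed.

Lemma deformed_br_split a b y :
  B a b y = br (N a) (N b) y + br (N a) b (N y) + br a (N b) (N y) + dbr a b y.
Proof. by []. Qed.

(** The five explicit terms form T4: each leaves exactly one place without [N]. *)
Lemma deformed_br_nested a b c d e :
  B a b (B c d e) =
    br (N a) (N b) (br (N c) (N d) e) + br (N a) (N b) (br (N c) d (N e))
    + br (N a) (N b) (br c (N d) (N e)) + br (N a) b (br (N c) (N d) (N e))
    + br a (N b) (br (N c) (N d) (N e))
    + (dbr a b (B c d e) + brn a b (dbr c d e)).
Proof.
rewrite [LHS]deformed_br_split N_deformed_br
  [in br _ _ (B _ _ _)]deformed_br_split /br_N !brE.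
zmod_cancel.
Qed.

Lemma deformed_br_trilinear : trilinear_op B.
Proof.
by split=> >; rewrite /deformed_br
  !(NE, NZ, brE, trilinearZ br_lin, scaleD, scaleN);
  zmod_cancel.
Qed.

Lemma deformed_br_skew : skew_symmetric3 B.
Proof.
split=> a b c; rewrite !deformed_br_split.
  rewrite dbr_skew.1 (br12 a (N b)) (br12 (N a) b) (br12 (N a)).
  zmod_cancel.
rewrite dbr_skew.2 (br23 _ b (N c)) (br23 _ (N b) c) (br23 _ (N b)).
zmod_cancel.
Qed.

Lemma deformed_br_rot a b c : B b c a = B a b c.
Proof. by rewrite deformed_br_skew.2 deformed_br_skew.1 opprK. Qed.

Lemma deformed_br_fundamental a b c d e :
  B a b (B c d e) = B (B a b c) d e + B c (B a b d) e + B c d (B a b e).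
Proof.
(* Rotations bring every inner bracket to the last slot, where [deformed_br_nested] applies. *)
rewrite -(deformed_br_rot (B a b c)) (deformed_br_rot e c (B a b d))
  !deformed_br_nested (dbr_cocycle a b).
rewrite !(br_fund_sym a) !(br_fund_sym (N a)).
zmod_cancel.
Qed.

(** * The deformed product *)

Lemma deformed_mul_bilinear : bilinear_op m.
Proof.
by split=> >;
  rewrite /deformed_mul !(NE, NZ, mulE, bilinearZ mul_lin, scaleD, scaleN);
  zmod_cancel.
Qed.

(** The analogue with three places, [- N (T1 - N T0)] for [mul a (mul b c)], obtained from
    [star_subN]. *)
Lemma star_deformed_mul a b c :
  star a (m b c) + dia a (star b c) =
  - N (mul a (mul (N b) c) + mul a (mul b (N c)) + mul (N a) (mul b c)
       - N (mul a (mul b c))).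
Proof.
rewrite /dia_N {2}/star_N mulE; have := star_subN a.
by rewrite /dia_N => ->; rewrite mulE.
Qed.

Lemma deformed_mul_split a y : m a y = mul (N a) y + mul a (N y) + star a y.
Proof. by []. Qed.

Lemma deformed_mul_nested a b c :
  m a (m b c) =
    mul (N a) (mul (N b) c) + mul (N a) (mul b (N c)) + mul a (mul (N b) (N c))
    + (star a (m b c) + dia a (star b c)).
Proof.
rewrite [LHS]deformed_mul_split N_deformed_mul
  [in mul _ (m _ _)]deformed_mul_split /dia_N !mulE.
zmod_cancel.
Qed.

Lemma mulCA a b c : mul a (mul b c) = mul b (mul a c).
Proof. by rewrite !mulA (mulC a). Qed.

Lemma star_deformed_mulCA a b c :
  star a (m b c) + dia a (star b c) = star b (m a c) + dia b (star a c).
Proof.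
rewrite !star_deformed_mul !(mulCA b) !(mulCA (N b)); congr (- N (_ - _)).
zmod_cancel.
Qed.

Lemma deformed_mulC : commutative m.
Proof.
move=> a b; rewrite /deformed_mul (mulC b a) (mulC (N b)) (mulC b (N a)).
zmod_cancel.
Qed.

Lemma deformed_mulA : associative m.
Proof.
(* For a commutative product, associativity amounts to this exchange, which the NS-commutative axiom
   also expresses. *)
have mCA a b c : m a (m b c) = m b (m a c).
  rewrite !deformed_mul_nested star_deformed_mulCA !(mulCA b) !(mulCA (N b)).
  zmod_cancel.
by move=> a b c; rewrite (deformed_mulC b) mCA deformed_mulC.
Qed.

(** * The Leibniz rule *)

(** Both sides equal [- N (T2 - N (T1 - N T0))] for the four places of [br a b (mul c d)], the right
    one after the Leibniz rule is applied to each Ti. *)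
Lemma dbr_deformed_mul a b c d :
  dbr a b (m c d) + brn a b (star c d) =
  dia c (dbr a b d) + star c (B a b d) + (dia d (dbr a b c) + star d (B a b c)).
Proof.
have E x y : dia y (dbr a b x) + star y (B a b x) =
  star y (br (N a) (N b) x + br (N a) b (N x) + br a (N b) (N x)
    - N (br (N a) b x + br a (N b) x + br a b (N x) - N (br a b x)))
  - dia y (N (br (N a) b x + br a (N b) x + br a b (N x) - N (br a b x))).
  by rewrite addrC /dia_N /dbr_N mulE.
rewrite !E !star_subN [brn a b (star c d)](_ : _ = - brn a b (N (mul c d)));
  last by rewrite /br_N /star_N brE.
rewrite dbr_subN N_deformed_mul !(brE, mulE, (nij_mul Nij), br_leib, NE).
rewrite !(mulC _ d) !(mulC _ (N d)).
zmod_cancel.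
Qed.

Lemma deformed_br_leibniz a b c d : B a b (m c d) = m (B a b c) d + m c
  (B a b d).
Proof.
rewrite (deformed_mulC (B a b c)) !(deformed_mul_split _ (B _ _ _))
  !N_deformed_br.
(* Solving [dbr_deformed_mul] for [dbr a b (m c d)] leaves only T3, the terms with [N] at three of
   the four places. *)
rewrite [LHS]deformed_br_split N_deformed_mul
  (canRL (addrK _) (dbr_deformed_mul a b c d)).
rewrite [in br _ _ (m _ _)]deformed_mul_split
  [in mul (N c) (B _ _ _)]deformed_br_split.
rewrite [in mul (N d) (B _ _ _)]deformed_br_split /dia_N /br_N
  !(brE, mulE, br_leib).
rewrite !(mulC _ d) !(mulC _ (N d)).
zmod_cancel.
Qed.

(** * The Nambu-Poisson and NS-Nambu-Poisson structures *)

Lemma deformed_Nambu_Poisson : is_Nambu_Poisson_algebra m B.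
Proof.
split; last exact: deformed_br_leibniz.
  by split;
    [exact: deformed_mul_bilinear | exact: deformed_mulC | exact: deformed_mulA].
by split; [exact: deformed_br_trilinear | exact: deformed_br_skew | exact: deformed_br_fundamental].
Qed.

Lemma NS_commutative_N : is_NS_commutative_algebra dia star.
Proof.
split; [exact: dia_bilinear | exact: star_bilinear | | |] => [a b|a b c|a b c].
- by rewrite /star_N mulC.
- by rewrite odot_deformed /dia_N N_deformed_mul mulA.
- by rewrite !odot_deformed addrC star_deformed_mulCA addrC.
Qed.

Lemma NS_3Lie_N : is_NS_3Lie_algebra brn dbr.
Proof.
split; [exact: brn_trilinear | exact: dbr_trilinear | | exact: dbr_skew | | |].
- by move=> a b c; rewrite /br_N br12.
- by move=> a b c d e; rewrite !bracket_deformed /br_N !N_deformed_br br_fund.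
- move=> a b c d e; rewrite bracket_deformed /br_N N_deformed_br.
  (* With the inner bracket rotated last, [br (N d) e] acts on it as a derivation. *)
  rewrite -(br_rot (br _ _ _)) br_fund !(br_rot _ (N d) e).
  rewrite (br_rot (N c) (N a)) -(br_rot (br (N a) _ _)).
  zmod_cancel.
- move=> a b c d e; rewrite !bracket_deformed dbr_cocycle.
  rewrite (dbr_rot (B a b c)) -(dbr_rot _ c (B a b d)).
  zmod_cancel.
Qed.

Lemma NS_Nambu_Poisson_N : is_NS_Nambu_Poisson_algebra dia star brn dbr.
Proof.
split; [exact: NS_commutative_N | exact: NS_3Lie_N | | |] => a b c d.
- by rewrite bracket_deformed /dia_N /br_N N_deformed_br br_leib addrK.
- rewrite odot_deformed /dia_N /br_N N_deformed_mul -br_rot br_leib.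
  by rewrite !(br_rot (N _)) addrC (mulC _ (N b)).
- rewrite odot_deformed !bracket_deformed dbr_deformed_mul
  (nsc_star_comm NS_commutative_N (B a b c)).
  zmod_cancel.
Qed.

End Nijenhuis.

(** The subadjacent and deformed operations are shown equal pointwise, so the structure is
    transported along pointwise equalities. *)
Lemma eq_Nambu_Poisson (k : fieldType) (A : lmodType k)
    (mul mul' : A -> A -> A) (br br' : A -> A -> A -> A) :
  (forall a b, mul' a b = mul a b) -> (forall a b c, br' a b c = br a b c) ->
  is_Nambu_Poisson_algebra mul br -> is_Nambu_Poisson_algebra mul' br'.
Proof.
move=> eqm eqb [[[m1 m2] mC mA] [[b1 b2 b3] [s1 s2] bF] L].
split; [split|split|].
- by split=> >; rewrite !eqm; [exact: m1 | exact: m2].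
- by move=> a b; rewrite !eqm.
- by move=> a b c; rewrite !eqm.
- by split=> >; rewrite !eqb; [exact: b1 | exact: b2 | exact: b3].
- by split=> a b c; rewrite !eqb.
- by move=> a b c d e; rewrite !eqb.
- by move=> a b c d; rewrite !eqm !eqb.
Qed.

Theorem theorem4p8 (k : fieldType) (char_k : [pchar k] =i pred0)
    (A : lmodType k) (mul : A -> A -> A) (br : A -> A -> A -> A)
    (NP : is_Nambu_Poisson_algebra mul br)
    (N : {linear A -> A}) (Nij : is_Nijenhuis_operator mul br N) :
  is_NS_Nambu_Poisson_algebra
    (dia_N mul N) (star_N mul N) (br_N br N) (dbr_N br N) /\
  [/\ is_Nambu_Poisson_algebra
        (ns_odot (dia_N mul N) (star_N mul N))
        (ns_bracket (br_N br N) (dbr_N br N)),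
      is_Nambu_Poisson_algebra (deformed_mul mul N) (deformed_br br N),
      forall a b : A,
        ns_odot (dia_N mul N) (star_N mul N) a b = deformed_mul mul N a b
    & forall a b c : A,
        ns_bracket (br_N br N) (dbr_N br N) a b c = deformed_br br N a b c].
Proof.
have NPN := deformed_Nambu_Poisson NP Nij.
split; first exact: NS_Nambu_Poisson_N.
split=> //; last by move=> a b c; rewrite (bracket_deformed NP).
  by apply: eq_Nambu_Poisson NPN => *; rewrite ?(odot_deformed NP)
    ?(bracket_deformed NP).
by move=> a b; rewrite (odot_deformed NP).
Qed.
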